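(* Consider a network of $N\ge 2$ reinforced stochastic processes with irreducible interaction matrix $W$ and sequence $(r_n)_{n\ge 0}$, $0\le r_n<1$, as defined in the context, and assume $P(T_0)<1$, where $T_0=\{\boldsymbol{Z}_0=\boldsymbol{0}\}\cup\{\boldsymbol{Z}_0=\boldsymbol{1}\}$. Assume that at least one of the following holds: (1) $\sum_n r_n=+\infty$ and $W$ is aperiodic; (2) $\sum_n r_n(1-r_n)=+\infty$. Let $Z_\infty$ be the common almost sure limit of the processes $(Z_{n,l})_n$, $l\in V$, and let $T_\infty=\{Z_\infty=0\}\cup\{Z_\infty=1\}$. If $$\sum_{n}\prod_{k=0}^n(1-r_k)<+\infty,$$ then $P(Z_\infty=z\mid T_0^c)>0$ for both $z=0$ and $z=1$, and so $P(T_\infty\mid T_0^c)>0$. More precisely, for both $z=0$ and $z=1$, there is a strictly positive probability, given $T_0^c$, of fixation of all the processes $\{(X_{n,l})_n: l\in V\}$ on the value $z$, i.e. $$P\big(\exists\, m\ge 1:\ X_{n,l}=z\ \text{ for all } n\ge m \text{ and all } l\in V \ \big|\ T_0^c\big)>0 .$$ In particular, the requirement that at least one of ''$\sum_n r_n=+\infty$ and $W$ is aperiodic'' or ''$\sum_n r_n(1-r_n)=+\infty$'' holds, and the summability condition $\sum_{n}\prod_{k=0}^n(1-r_k)<+\infty$, are both satisfied when $\lim_n n^\gamma r_n=c$ and the series $\sum_{n\ge1}(r_n-cn^{-\gamma})$ is convergent, with either $\gamma=1$ and $c>1$, or $1/2<\gamma<1$ and $c>0$.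
   Context: Network of reinforced stochastic processes: $V=\{1,\dots,N\}$, $N\ge 2$; $W=[w_{l_1,l_2}]_{l_1,l_2\in V}$ is a deterministic matrix with entries $w_{l_1,l_2}\ge 0$ and $\sum_{l_1=1}^N w_{l_1,l_2}=1$ for each $l_2\in V$ (i.e. $W^\top\boldsymbol{1}=\boldsymbol{1}$). $\{Z_{0,l}:l\in V\}$ are random variables with values in $[0,1]$; for each $n\ge 1$, $\{X_{n,l}:l\in V\}$ are random variables with values in $\{0,1\}$. Put $\mathcal{F}_n=\sigma(Z_{0,l}:l\in V)\vee\sigma(X_{k,l}:1\le k\le n,\ l\in V)$. For each $n\ge 0$, the variables $\{X_{n+1,l}:l\in V\}$ are conditionally independent given $\mathcal{F}_n$ with $P(X_{n+1,l}=1\mid\mathcal{F}_n)=\sum_{l_1=1}^N w_{l_1,l}Z_{n,l_1}$ a.s., and $Z_{n+1,l}=(1-r_n)Z_{n,l}+r_nX_{n+1,l}$ for each $l\in V$, where $(r_n)_{n\ge 0}$ is a deterministic sequence with $0\le r_n<1$. Notation: $\boldsymbol{Z}_n=(Z_{n,1},\dots,Z_{n,N})^\top$; $\boldsymbol{0}$ and $\boldsymbol{1}$ are the vectors with all entries $0$, respectively $1$. Periodicity: the period of $l\in V$ is the greatest common divisor of the integers $n\ge 1$ with $(W^n)_{l,l}>0$; if $W$ is irreducible all periods coincide, and $W$ is aperiodic if this common period is $1$. Known fact (complete almost sure asymptotic synchronization): when $W$ is irreducible and (1) or (2) holds, all the processes $(Z_{n,l})_n$, $l\in V$, converge almost surely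 to one and the same random variable $Z_\infty$. *)

(* Defs.v *)
From HB Require Import structures.
From mathcomp Require Import all_boot all_order all_algebra.
From mathcomp Require Import all_classical all_reals all_analysis.

Set Implicit Arguments.
Unset Strict Implicit.
Unset Printing Implicit Defensive.

Import Order.TTheory GRing.Theory Num.Theory.
Import numFieldNormedType.Exports.

Local Open Scope classical_set_scope.
Local Open Scope ring_scope.

Section NonnegativeMatrices.
Context {R : numDomainType} {N : nat}.
Implicit Types W : 'M[R]_N.

Definition irreducible_mx W : Prop :=
  forall i j : 'I_N, exists2 n : nat, (0 < n)%N & 0 < (W ^+ n) i j.

(* [d] is the gcd of the (infinite) set of all n >= 1 with (W^n)_{l,l} > 0. *)
Definition is_period W (l : 'I_N) (d : nat) : Prop :=
  (forall n : nat, (0 < n)%N -> 0 < (W ^+ n) l l -> (d %| n)%N) /\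
  (forall e : nat,
     (forall n : nat, (0 < n)%N -> 0 < (W ^+ n) l l -> (e %| n)%N) ->
     (e %| d)%N).

Definition aperiodic_mx W : Prop := forall l : 'I_N, is_period W l 1%N.

End NonnegativeMatrices.

Section Conditioning.
Context d (T : measurableType d) (R : realType) (P : probability T R).

Definition cond_prob_event (A B : set T) : R :=
  fine (P (A `&` B)) / fine (P B).

(* [Y] is a version of P(A | G); when [Y] is an explicit expression, this is
   what "P(A | G) = Y a.s." means.  The first condition says that [Y] is
   G-measurable, [G] being a sigma-algebra. *)
Definition is_cond_prob (G : set (set T)) (A : set T) (Y : T -> R) : Prop :=
  [/\ g_sigma_algebra_preimage Y `<=` G,
      P.-integrable setT (EFin \o Y) &
      forall B : set T, G B -> (\int[P]_(w in B) (Y w)%:E = P (A `&` B))%E].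

(* Versions exist and are a.s. unique, so that the quantification over them is
   not a restriction; subfamilies of [I] are covered by taking [B i = setT]. *)
Definition cond_independent (G : set (set T)) (I : finType)
    (X : I -> T -> R) : Prop :=
  forall (B : I -> set R) (Y : I -> T -> R),
    (forall i, measurable (B i)) ->
    (forall i, is_cond_prob G (X i @^-1` B i) (Y i)) ->
    is_cond_prob G (\bigcap_i (X i @^-1` B i)) (fun w => \prod_i Y i w).

End Conditioning.

Section ReinforcedNetwork.
Context d (T : measurableType d) (R : realType) (P : probability T R).
Context (N : nat) (W : 'M[R]_N) (r : nat -> R).
Context (Z X : nat -> 'I_N -> {RV P >-> R}).

Definition network_filtration (n : nat) : set (set T) :=
  <<s (\bigcup_l g_sigma_algebra_preimage (Z 0%N l)) `|`
      (\bigcup_(k in [set k | (1 <= k <= n)%N])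
         \bigcup_l g_sigma_algebra_preimage (X k l)) >>.

(* The [X n l] are only meaningful for n >= 1: [X 0] is a dummy, which no
   condition mentions. *)
Record reinforced_network : Prop := ReinforcedNetwork {
  network_W_ge0 : forall l1 l2 : 'I_N, 0 <= W l1 l2;
  network_W_sum1 : forall l2 : 'I_N, \sum_l1 W l1 l2 = 1;
  network_r : forall n, 0 <= r n < 1;
  network_Z0 : forall l w, 0 <= Z 0%N l w <= 1;
  network_X01 : forall n l w, X n.+1 l w = 0 \/ X n.+1 l w = 1;
  network_indep : forall n,
    cond_independent P (network_filtration n) (fun l => X n.+1 l : T -> R);
  network_prob : forall n l,
    is_cond_prob P (network_filtration n) [set w | X n.+1 l w = 1]
      (fun w => \sum_l1 W l1 l * Z n l1 w);
  network_rec : forall n l w,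
    Z n.+1 l w = (1 - r n) * Z n l w + r n * X n.+1 l w
}.

Definition trivial_start : set T :=
  [set w | forall l, Z 0%N l w = 0] `|` [set w | forall l, Z 0%N l w = 1].

Definition fixation (z : R) : set T :=
  [set w | exists2 m : nat, (1 <= m)%N &
     forall n l, (m <= n)%N -> X n l w = z].

Definition is_common_limit (Zinf : {RV P >-> R}) : Prop :=
  forall l, {ae P, forall w, (fun n => Z n l w) @ \oo --> Zinf w}.

End ReinforcedNetwork.

Section StepSizes.
Context {R : realType} {N : nat}.
Implicit Types (W : 'M[R]_N) (r : nat -> R).

Definition sync_condition W r : Prop :=
  ((\sum_(0 <= n <oo) (r n)%:E = +oo)%E /\ aperiodic_mx W) \/
  (\sum_(0 <= n <oo) (r n * (1 - r n))%:E = +oo)%E.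

Definition summable_prod r : Prop :=
  (\sum_(0 <= n <oo) (\prod_(0 <= k < n.+1) (1 - r k))%:E < +oo)%E.

End StepSizes.

(* Main.v *)
(* Let U_n = |Z_n - z|, so that fixation on z drives U to 0, and let
   a_n = \prod_(k < n) (1 - r_k).  Summability of (a_n) forces r_n > 0
   infinitely often, so by irreducibility the property U < 1 spreads, with
   positive probability, from one coordinate (there is one off the trivial
   start) to all of them, say at time n0.  As long as every later X equals z
   one has U_n <= a_n / a_n0, hence each further step of the fixation has
   positive conditional probability, at least (1 - a_n / a_n0)^N
   >= 1 - N a_n / a_n0.  The tails of this series are small, so the
   probabilities stay bounded away from 0.

   For the step sizes of the last part, r_n >= c'/n eventually for some
   c' > 1; Raabe's test and the divergence of the harmonic series conclude. *)

Require Import Defs.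
From HB Require Import structures.
From mathcomp Require Import all_boot all_order all_algebra.
From mathcomp Require Import all_classical all_reals all_analysis.
From mathcomp Require Import measurable_realfun ring lra.

Set Implicit Arguments.
Unset Strict Implicit.
Unset Printing Implicit Defensive.

Import Order.TTheory GRing.Theory Num.Theory.
Import numFieldNormedType.Exports.

Local Open Scope classical_set_scope.
Local Open Scope ring_scope.

(** * Series of nonnegative terms and power-law step sizes *)

Section StepSizeLemmas.
Context {R : realType}.
Implicit Types (u r : nat -> R).

Lemma nneseries_ltey_bound u (M : R) : (forall n, 0 <= u n) ->
  (forall n, \sum_(0 <= k < n) u k <= M) ->
  (\sum_(0 <= n <oo) (u n)%:E < +oo)%E.
Proof.
move=> u0 uM; apply: (@le_lt_trans _ _ M%:E); last exact: ltry.
apply: lime_le.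
  by apply: is_cvg_nneseries => n _ _; rewrite lee_fin.
by near=> n; rewrite sumEFin lee_fin.
Unshelve. all: by end_near. Qed.

Lemma nneseries_tail_le u (e : R) : (forall n, 0 <= u n) ->
  (\sum_(0 <= n <oo) (u n)%:E < +oo)%E -> 0 < e ->
  exists J, forall j m, (J <= j)%N -> \sum_(j <= k < m) u k <= e.
Proof.
move=> u0 u_fin e0.
have u0E : forall k, xpredT k -> (0 <= (u k)%:E)%E by move=> k _; rewrite lee_fin.
have tail0 := nneseries_tail_cvg u_fin u0E.
have [J _ HJ] : \forall j \near \oo, (\sum_(j <= k <oo) (u k)%:E < e%:E)%E.
  by apply: (tail0 [set y | (y < e%:E)%E]); apply: open_ereal_lt'; rewrite lte_fin.
exists J => j m Jj; rewrite -lee_fin -sumEFin.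
apply: le_trans (ltW (HJ j Jj)); apply: nneseries_lim_ge => n _ _; exact: u0E.
Qed.

(** If the series were finite, some tail of it would be at most [c]; dividing by [c] keeps the
    harmonic tail below 1, against the divergence of the harmonic series. *)
Lemma nneseries_harmonic_pinfty u (c : R) (n0 : nat) : 0 < c ->
  (forall n, 0 <= u n) -> (forall n, (n0 <= n)%N -> c / n.+1%:R <= u n) ->
  (\sum_(0 <= n <oo) (u n)%:E = +oo)%E.
Proof.
move=> c0 u0 u_ge; apply/eqP; rewrite -leye_eq leNgt; apply/negP => u_fin.
have [J HJ] := nneseries_tail_le u0 u_fin c0.
apply: (@dvg_harmonic R).
pose K := maxn J n0.
apply: nondecreasing_is_cvgn.
  by apply: nondecreasing_series => n _ _; rewrite harmonic_ge0.
exists (series harmonic K + 1) => _ [m _ <-].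
have sum_ge0 i j : 0 <= \sum_(i <= k < j) @harmonic R k.
  by apply: sumr_ge0 => k _; exact: harmonic_ge0.
rewrite /series /=; have [Km|mK] := leqP K m; last first.
  rewrite (big_cat_nat (n := m) _ (ltnW mK)) //= -addrA lerDl addr_ge0 //.
rewrite (big_cat_nat (n := K)) //= lerD2l -(ler_pM2l c0) mulr1.
apply: le_trans (HJ K m (leq_maxl _ _)).
rewrite mulr_sumr big_nat_cond [leRHS]big_nat_cond; apply: ler_sum => k.
rewrite andbT => /andP[Kk _]; apply: u_ge; exact: leq_trans (leq_maxr _ _) Kk.
Qed.

Lemma cvgn_le_near u (l M : R) : u @ \oo --> l -> l < M ->
  exists n0, forall n, (n0 <= n)%N -> u n <= M.
Proof.
move=> ul lM; have [n0 _ H] := cvgr_le l ul M lM.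
by exists n0 => n n0n; exact: H.
Qed.

Lemma cvgn_ge_near u (l M : R) : u @ \oo --> l -> M < l ->
  exists n0, forall n, (n0 <= n)%N -> M <= u n.
Proof.
move=> ul lM; have [n0 _ H] := cvgr_ge l ul M lM.
by exists n0 => n n0n; exact: H.
Qed.

Lemma powR_nat_ge_near (e M : R) : 0 < e -> 0 <= M ->
  exists n0, forall n, (n0 <= n)%N -> M <= n%:R `^ e.
Proof.
move=> e0 M0; exists (Num.bound (M `^ e^-1)) => n hn.
have h : M `^ e^-1 <= n%:R.
  apply: le_trans (ltW (archi_boundP (powR_ge0 _ _))) _.
  by rewrite ler_nat.
have ME : M = (M `^ e^-1) `^ e by rewrite -powRrM mulVf ?lt0r_neq0 // powRr1.
rewrite {1}ME.
by apply: ge0_ler_powR => //; rewrite ?nnegrE ?powR_ge0 // ltW.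
Qed.

(** For [gamma = 1] the midpoint of 1 and [c] serves. For [gamma < 1] the factor [n ^ (1 - gamma)]
    makes [n * r n] tend to infinity, so any constant above 1 would do. *)
Lemma step_size_lower (r : nat -> R) (gamma c : R) :
  (gamma = 1 /\ 1 < c) \/ (1 / 2 < gamma < 1 /\ 0 < c) ->
  (fun n : nat => n%:R `^ gamma * r n) @ \oo --> c ->
  exists2 c' : R, 1 < c' &
    exists n0, forall n, (n0 <= n)%N -> c' <= n%:R * r n.
Proof.
case=> [[-> c1]|[/andP[g0 g1] c0]] rc.
  exists ((1 + c) / 2); first by lra.
  have [|n0 H] := @cvgn_ge_near _ c ((1 + c) / 2) rc; first by lra.
  by exists n0 => n /H; rewrite powRr1.
(* Here 2 is the product of the lower bounds [4 / c] and [c / 2] on the two factors of [n * r n]. *)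
exists 2; first by lra.
have [|n0 H] := @cvgn_ge_near _ c (c / 2) rc; first by lra.
have [||n1 H1] := @powR_nat_ge_near (1 - gamma) (4 / c).
- lra.
- by rewrite divr_ge0 // ltW.
exists (maxn (maxn n0 n1) 1) => n; rewrite !geq_max => /andP[/andP[/H h0 /H1 h1] n1'].
have -> : n%:R * r n = n%:R `^ (1 - gamma) * (n%:R `^ gamma * r n).
  rewrite mulrA -powRD ?subrK ?powRr1 //.
  by apply/implyP => _; rewrite pnatr_eq0 -lt0n.
have -> : 2 = (4 / c) * (c / 2) by field; rewrite lt0r_neq0.
by apply: ler_pM => //; rewrite divr_ge0 // ltW.
Qed.

Lemma step_size_upper (r : nat -> R) (gamma c : R) : 0 < gamma -> 0 < c ->
  (fun n : nat => n%:R `^ gamma * r n) @ \oo --> c ->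
  exists n0, forall n, (n0 <= n)%N -> r n <= 1 / 2.
Proof.
move=> g0 c0 rc.
have [|n0 H] := @cvgn_le_near _ c (c * 2) rc; first by lra.
have [||n1 H1] := @powR_nat_ge_near gamma (4 * c); [by []|by rewrite mulr_ge0 // ltW|].
exists (maxn n0 n1) => n; rewrite geq_max => /andP[/H h0 /H1 h1].
(* Nonpositive [r n] is set apart, because the bound [4 * c <= n ^ gamma] is next multiplied by
   [r n]. *)
have [|r0] := leP (r n) 0; first by move=> /le_trans; apply; lra.
have : 4 * c * r n <= c * 2 by apply: le_trans h0; rewrite ler_pM2r.
have -> : 4 * c * r n = c * (4 * r n) by ring.
by rewrite ler_pM2l // => ?; lra.
Qed.

(* Raabe's test: if [n * r n >= c'] then [a n = \prod_(k <= n) (1 - r k)]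
   satisfies [(c' - 1) * a (n-1) <= (n - 1) * a (n-1) - n * a n], which
   telescopes. *)
Lemma raabe_summable_prod r (c' : R) (n0 : nat) : (forall n, 0 <= r n < 1) ->
  1 < c' -> (forall n, (n0 <= n)%N -> c' <= n%:R * r n) -> summable_prod r.
Proof.
move=> r01 c1 rn; rewrite /summable_prod.
pose a n := \prod_(0 <= k < n.+1) (1 - r k).
have a0 n : 0 <= a n.
  by apply: prodr_ge0 => k _; rewrite subr_ge0 ltW //; case/andP: (r01 k).
have step n : (n0 <= n)%N -> (c' - 1) * a n <= n%:R * a n - n.+1%:R * a n.+1.
  move=> n0n; have := rn n.+1 (leqW n0n).
  rewrite {3}/a big_nat_recr //= -/(a n) => h.
  rewrite -subr_ge0.
  have -> : n%:R * a n - n.+1%:R * (a n * (1 - r n.+1)) - (c' - 1) * a n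
    = a n * (n.+1%:R * r n.+1 - c') by rewrite -(natr1 n); ring.
  by rewrite mulr_ge0 // subr_ge0.
have tel m : (c' - 1) * \sum_(n0 <= k < n0 + m) a k <=
    n0%:R * a n0 - (n0 + m)%:R * a (n0 + m)%N.
  elim: m => [|m IH]; first by rewrite addn0 big_geq // mulr0 subrr.
  rewrite addnS big_nat_recr ?leq_addr //= mulrDr.
  have := step (n0 + m)%N (leq_addr _ _); lra.
apply: (@nneseries_ltey_bound _ (\sum_(0 <= k < n0) a k + n0%:R * a n0 / (c' - 1))) => // n.
have c10 : 0 < c' - 1 by rewrite subr_gt0.
have sum_ge0 i j : 0 <= \sum_(i <= k < j) a k by apply: sumr_ge0.
apply: (@le_trans _ _ (\sum_(0 <= k < n0 + n) a k)).
  by rewrite (big_cat_nat (n := n) (p := (n0 + n)%N)) ?leq_addl //= lerDl.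
rewrite (big_cat_nat (n := n0)) ?leq_addr //= lerD2l ler_pdivlMr // mulrC.
apply: le_trans (tel n) _; rewrite gerDl oppr_le0 mulr_ge0 //.
Qed.

End StepSizeLemmas.

(** The second alternative of [sync_condition] is the one proved: eventually [r n >= 1 / (n + 1)]
    and [1 - r n >= 1 / 2], so the series dominates half the harmonic one. *)
Lemma step_size_conditions (R : realType) (N : nat) (W : 'M[R]_N)
    (r : nat -> R) (gamma c : R) :
  (forall n, 0 <= r n < 1) ->
  (gamma = 1 /\ 1 < c) \/ (1 / 2 < gamma < 1 /\ 0 < c) ->
  (fun n : nat => n%:R `^ gamma * r n) @ \oo --> c ->
  sync_condition W r /\ summable_prod r.
Proof.
move=> r01 gc rc; have [c' c1 [n0 H]] := step_size_lower gc rc.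
split; last exact: raabe_summable_prod r01 c1 H.
right.
have [n1 H1] : exists n1, forall n, (n1 <= n)%N -> r n <= 1 / 2.
  by case: gc => [[g1 ?]|[/andP[? ?] ?]]; apply: step_size_upper rc; lra.
apply: (@nneseries_harmonic_pinfty _ _ (1 / 2) (maxn n0 n1)) => [|n|n]; first by lra.
  by case/andP: (r01 n) => ? ?; rewrite mulr_ge0 // subr_ge0 ltW.
rewrite geq_max => /andP[/H h /H1 h1].
case/andP: (r01 n) => ? ?.
rewrite ler_pdivrMr // -(natr1 n).
have A1 : 1 <= r n * (n%:R + 1) by lra.
have : 0 <= (r n * (n%:R + 1) - 1) * (1 - r n) by rewrite mulr_ge0 // subr_ge0 // ltW.
lra.
Qed.

(** * Auxiliary facts on integrals, irreducible matrices and powers *)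

Lemma integral_gt0 d (T : measurableType d) (R : realType)
    (mu : {measure set T -> \bar R}) (B : set T) (f : T -> R) :
  measurable B -> measurable_fun B f -> (forall w, B w -> 0 < f w) ->
  (0 < mu B -> 0 < \int[mu]_(w in B) (f w)%:E)%E.
Proof.
move=> mB mf f0 B0.
have int0 : (0 <= \int[mu]_(w in B) (f w)%:E)%E.
  by apply: integral_ge0 => w Bw; rewrite lee_fin ltW // f0.
rewrite lt0e int0 andbT; apply/negP => /eqP fB.
have fa : (\int[mu]_(w in B) `|(f w)%:E|)%E = 0%E.
  rewrite -fB; apply: eq_integral => w; rewrite inE => Bw.
  by rewrite gee0_abs // lee_fin ltW // f0.
have [+ _] := @ae_eq_integral_abs _ _ _ mu B mB _ ((measurable_EFinP B f).2 mf).
move=> /(_ fa) f_ae.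
suff /(measure_negligible mB) muB0 : mu.-negligible B by rewrite muB0 ltxx in B0.
apply: negligibleS f_ae => w Bw /= /(_ Bw) [fw0].
by have := f0 w Bw; rewrite fw0 ltxx.
Qed.

(** Without an edge leaving [S], the block of [W ^ n] with rows in [S] and columns outside vanishes
    for every [n], by induction, so no power joins [i] to [j]. *)
Lemma irreducible_out_edge (R : numDomainType) (N : nat) (W : 'M[R]_N)
    (S : {set 'I_N}) :
  (forall i j, 0 <= W i j) -> irreducible_mx W ->
  (exists i, i \in S) -> (exists j, j \notin S) ->
  exists i j, [/\ i \in S, j \notin S & 0 < W i j].
Proof.
move=> W0 Wirr [i iS] [j jS]; apply: contrapT => no_edge.
have W_out k l : k \in S -> l \notin S -> W k l = 0.
  move=> kS lS; apply: contrapT => /eqP Wkl; apply: no_edge; exists k, l.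
  by rewrite lt0r Wkl W0.
have Wn_out n : forall k l, k \in S -> l \notin S -> (W ^+ n) k l = 0.
  elim: n => [|n IH] k l kS lS.
    by rewrite expr0 mxE; case: eqVneq => // kl; rewrite -kl kS in lS.
  rewrite exprS mxE big1 // => m _; have [mS|mS] := boolP (m \in S).
    by rewrite IH // mulr0.
  by rewrite W_out // mul0r.
have [n _] := Wirr i j.
by rewrite Wn_out // ltxx.
Qed.

Lemma bernoulli_ineq (R : realDomainType) (x : R) (n : nat) : 0 <= x <= 1 ->
  1 - n%:R * x <= (1 - x) ^+ n.
Proof.
move=> /andP[x0 x1]; elim: n => [|n IH]; first by rewrite mul0r subr0 expr0.
rewrite exprS; apply: (@le_trans _ _ ((1 - x) * (1 - n%:R * x))); last first.
  by rewrite ler_wpM2l // subr_ge0.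
have : 0 <= n%:R * x * x by rewrite !mulr_ge0.
rewrite -(natr1 n); lra.
Qed.

(** * Absorption at 0 of an abstract reinforced system *)

Section Absorption.
Context d (T : measurableType d) (R : realType) (P : probability T R).
Context (N : nat) (W : 'M[R]_N) (r : nat -> R).
Context (U : nat -> 'I_N -> T -> R) (E : nat -> 'I_N -> set T).
Context (G : nat -> set (set T)).
Context (W_ge0 : forall i j, 0 <= W i j).
Context (W_sum1 : forall j, \sum_i W i j = 1).
Context (W_irr : irreducible_mx W).
Context (r01 : forall n, 0 <= r n < 1) (r_summable : summable_prod r).
Context (U01 : forall n l w, 0 <= U n l w <= 1).
Context (U_in : forall n l w, E n l w -> U n.+1 l w = (1 - r n) * U n l w).
Context (U_le : forall n l w, U n.+1 l w <= (1 - r n) * U n l w + r n).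
Context (G_sub : forall n, G n `<=` measurable).
Context (G_setI : forall n A B, G n A -> G n B -> G n (A `&` B)).
Context (G_incr : forall n, G n `<=` G n.+1).
Context (G_E : forall n l, G n.+1 (E n l)).
Context (G_bigcapE : forall n, G n.+1 (\bigcap_l E n l)).

(** In the application [U] is the distance of [Z] to the target value, [E n l] the event that
    [X n.+1 l] hits the target, and [G] the network filtration; [q] is then the conditional
    probability of hitting. *)
Let q n l w := 1 - \sum_l1 W l1 l * U n l1 w.

Context (E_prob : forall n l, is_cond_prob P (G n) (E n l) (q n l)).
Context (bigcapE_prob : forall n,
  is_cond_prob P (G n) (\bigcap_l E n l) (fun w => \prod_l q n l w)).

Let a n := \prod_(0 <= k < n) (1 - r k).

Let r1_gt0 n : 0 < 1 - r n.
Proof. by rewrite subr_gt0; case/andP: (r01 n). Qed.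

Let a_gt0 n : 0 < a n.
Proof. by apply: prodr_gt0. Qed.

Let a_anti m n : (m <= n)%N -> a n <= a m.
Proof.
move=> mn; rewrite /a (big_cat_nat (n := m)) //= ler_piMr //; first exact/ltW/a_gt0.
apply: prodr_ile1 => k _; case/andP: (r01 k) => *; apply/andP; split; lra.
Qed.

(** The shift in [a k.+1] comes from [summable_prod], whose products run over [k < n.+1]. *)
Let a_tail (e : R) : 0 < e ->
  exists J, forall j m, (J <= j)%N -> \sum_(j <= k < m) a k.+1 <= e.
Proof.
move=> e0; apply: nneseries_tail_le e0; last exact: r_summable.
by move=> n; exact/ltW/a_gt0.
Qed.

Let a_small (e : R) : 0 < e -> exists n, a n <= e.
Proof.
move=> /a_tail[J HJ]; exists J.+1.
by have := HJ J J.+1 (leqnn _); rewrite big_nat1.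
Qed.

(** If [r] vanished from [n] on, [a] would stay at the positive value [a n] and could not become
    small. *)
Let r_gt0_often n : exists2 m, (n <= m)%N & 0 < r m.
Proof.
apply: contrapT => no_m.
have rE m : (n <= m)%N -> r m = 0.
  move=> nm; apply/eqP; rewrite eq_le; case/andP: (r01 m) => -> _; rewrite andbT leNgt.
  by apply/negP => ?; apply: no_m; exists m.
have aE m : a (n + m) = a n.
  elim: m => [|m IH]; first by rewrite addn0.
  by rewrite addnS /a big_nat_recr //= -/(a _) IH rE ?leq_addr // subr0 mulr1.
have [|m] := @a_small (a n / 2); first by rewrite divr_gt0.
have := a_anti (leq_addl n m); rewrite aE => ? ?; have := a_gt0 n; lra.
Qed.

(** Since the columns of [W] sum to 1, [q] is a weighted average of the [1 - U]; its positivity and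
    its lower bounds are read off from this form. *)
Let q_sum n l w : q n l w = \sum_l1 W l1 l * (1 - U n l1 w).
Proof.
rewrite /q -{1}(W_sum1 l) -sumrB; apply: eq_bigr => i _; ring.
Qed.

Let q_ge n l w b : (forall i, U n i w <= b) -> 1 - b <= q n l w.
Proof.
move=> Ub; rewrite q_sum -[leLHS]mul1r -(W_sum1 l) mulr_suml.
by apply: ler_sum => i _; rewrite ler_wpM2l // lerD2l lerN2.
Qed.

Let q_gt0 n i l w : 0 < W i l -> U n i w < 1 -> 0 < q n l w.
Proof.
move=> Wil Ui; rewrite q_sum (bigD1 i) //= ltr_pwDl ?mulr_gt0 ?subr_gt0 //.
by apply: sumr_ge0 => k _; rewrite mulr_ge0 // subr_ge0; case/andP: (U01 n k w).
Qed.

Let q_gt0_all n l w : (forall i, U n i w < 1) -> 0 < q n l w.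
Proof.
move=> U1; have [i /= /q_gt0 ->//] : exists i, 0 < W i l.
have [||i] := @psumr_neq0P R _ xpredT (fun i => W i l).
- by [].
- by rewrite W_sum1; apply/eqP/oner_neq0.
by move=> ?; exists i.
Qed.

(** The probability of the intersection is the integral of [Y] over [B]. Every extension of an event
    by one more favourable draw rests on this. *)
Let cond_prob_gt0 (GG : set (set T)) A Y B : GG `<=` measurable ->
  is_cond_prob P GG A Y -> GG B -> (0 < P B)%E ->
  (forall w, B w -> 0 < Y w) -> (0 < P (B `&` A))%E.
Proof.
move=> GGm [_ Yint YP] GB PB Y0; rewrite setIC -YP //.
apply: integral_gt0 => //; first exact: GGm.
have /measurable_int/measurable_EFinP := Yint.
by apply: measurable_funS => //.
Qed.

Let U_lt1 n l w : U n l w < 1 -> U n.+1 l w < 1.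
Proof.
move=> U1; apply: le_lt_trans (U_le n l w) _.
have := r1_gt0 n => r1.
have : (1 - r n) * U n l w < (1 - r n) * 1 by rewrite ltr_pM2l.
lra.
Qed.

Let U_lt1_iter n m l w : (n <= m)%N -> U n l w < 1 -> U m l w < 1.
Proof.
move=> nm U1; rewrite -(subnKC nm); elim: (m - n)%N => [|k IH].
  by rewrite addn0.
by rewrite addnS; exact: U_lt1.
Qed.

Let G_le n m : (n <= m)%N -> G n `<=` G m.
Proof.
move=> nm B GB; rewrite -(subnKC nm); elim: (m - n)%N => [|k IH].
  by rewrite addn0.
by rewrite addnS; exact: G_incr.
Qed.

(* The set S of coordinates known to lie below 1 grows along an edge of W
   leaving S, with positive probability, at each time with [r n > 0]. *)
Let spread k : forall n (S : {set 'I_N}) B, (#|(~: S)%SET| <= k)%N ->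
  (exists i, i \in S) -> G n B -> (0 < P B)%E -> (forall l w, l \in S -> B w -> U n l w < 1) ->
  exists m B', [/\ B' `<=` B, G m B', (0 < P B')%E &
    forall l w, B' w -> U m l w < 1].
Proof.
elim: k => [|k IH] n S B Sk S0 GB PB US.
  exists n, B; split=> // l w; apply: US.
  have := Sk; rewrite leqn0 => /eqP/card0_eq/(_ l).
  by rewrite !inE => /negbFE.
have [/existsP ST|] := boolP [exists j, j \notin S]; last first.
  rewrite negb_exists => /forallP ST.
  by exists n, B; split=> // l w; apply: US; have := ST l; rewrite negbK.
have [i [j [iS jS Wij]]] := irreducible_out_edge W_ge0 W_irr S0 ST.
have [m nm rm] := r_gt0_often n.
have GmB := G_le nm GB.
have GBE : G m.+1 (B `&` E m j) by apply: G_setI => //; exact: G_incr.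
have PBE : (0 < P (B `&` E m j))%E.
  apply: cond_prob_gt0 (@G_sub m) (E_prob m j) GmB PB _ => w Bw.
  by apply: q_gt0 Wij _; apply: U_lt1_iter nm _; exact: US.
have [|||m' [B' [B'B GB' PB' UB']]] := IH m.+1 (j |: S)%SET (B `&` E m j) _ _ GBE PBE.
- have jS' : j \in (~: S)%SET by rewrite inE.
  have -> : (~: (j |: S) = (~: S) :\ j)%SET.
    by apply/setP => y; rewrite !inE negb_or.
  by move: Sk; rewrite (cardsD1 j) jS'.
- by exists j; rewrite !inE eqxx.
- move=> l w /setU1P[->|lS] [Bw Ejw].
    (* The new coordinate [j] may still have [U m j w = 1]: the strict inequality after the step
       comes from [0 < r m]. *)
    rewrite U_in //; have := U01 m j w => /andP[U0 U1].
    have : r m * (1 - U m j w) >= 0 by rewrite mulr_ge0 ?subr_ge0 // ltW.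
    have : (1 - r m) * U m j w <= (1 - r m) * 1 by rewrite ler_pM2l.
    lra.
  by apply: U_lt1_iter (leqW nm) _; exact: US.
exists m', B'; split=> //; exact: subset_trans B'B (@subIsetl _ _ _).
Qed.

(** * Fixation once all coordinates lie below 1 *)

Section Fixation.
Context (n0 : nat) (B : set T).
Context (GB : G n0 B) (PB : (0 < P B)%E).
Context (UB : forall l w, B w -> U n0 l w < 1).

(** The event that [B] holds and that all draws have hit the target during the [j] steps after time
    [n0]. *)
Let F := fix F j :=
  if j is j'.+1 then F j' `&` \bigcap_l E (n0 + j')%N l else B.

Let G_F j : G (n0 + j)%N (F j).
Proof.
elim: j => [|j IH] /=; first by rewrite addn0.
by rewrite addnS; apply: G_setI => //; exact: G_incr.
Qed.

Let mF j : measurable (F j).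
Proof. exact/G_sub/G_F. Qed.

Let F_anti : {homo F : n m / (n <= m)%N >-> (m <= n)%O}.
Proof.
move=> n m nm; apply/subsetPset; rewrite -(subnKC nm).
elim: (m - n)%N => [|k IH]; first by rewrite addn0.
by rewrite addnS /=; apply: subset_trans IH; exact: subIsetl.
Qed.

Let F_sub j : F j `<=` B.
Proof. by have := F_anti (leq0n j) => /subsetPset. Qed.

(** During fixation each step multiplies [U] by [1 - r n]; the resulting quotient of products is
    written cross-multiplied. *)
Let U_F j l w : F j w -> U (n0 + j)%N l w * a n0 = U n0 l w * a (n0 + j)%N.
Proof.
elim: j => [|j IH] /=; first by rewrite addn0.
move=> [Fj Ej]; rewrite addnS U_in; last exact: Ej.
by rewrite {2}/a big_nat_recr //= -/(a _) mulrA -IH //; ring.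
Qed.

(** The quantitative bound [p_step] may have a negative factor for small [j], so positivity at each
    finite stage is obtained from [U < 1] alone. *)
Let P_F_gt0 j : (0 < P (F j))%E.
Proof.
elim: j => [|j IH] //=.
apply: cond_prob_gt0 (@G_sub _) (bigcapE_prob (n0 + j)%N) (G_F j) IH _ => w Fw.
apply: prodr_gt0 => l _; apply: q_gt0_all => i.
by apply: U_lt1_iter (leq_addr _ _) _; apply: UB; exact: F_sub Fw.
Qed.

Let x j := a (n0 + j)%N / a n0.

Let x01 j : 0 <= x j <= 1.
Proof.
apply/andP; split; first by rewrite divr_ge0 // ltW.
rewrite ler_pdivrMr // mul1r.
by apply: a_anti; exact: leq_addr.
Qed.

Let U_F_le j l w : F j w -> U (n0 + j)%N l w <= x j.
Proof.
move=> /(U_F l) UF; rewrite /x ler_pdivlMr // UF ler_piMl //; first exact/ltW.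
by case/andP: (U01 n0 l w).
Qed.

Let p j := fine (P (F j)).

Let pE j : P (F j) = (p j)%:E.
Proof. by rewrite fineK // fin_num_measure. Qed.

Let p_gt0 j : 0 < p j.
Proof. by rewrite -lte_fin -pE. Qed.

(** On [F j] each of the [N] factors [q] is at least [1 - x j]; Bernoulli's inequality bounds their
    product, which is integrated over [F j]. *)
Let p_step j : (1 - N%:R * x j) * p j <= p j.+1.
Proof.
have [_ qint qP] := bigcapE_prob (n0 + j)%N.
have FS : F j.+1 = F j `&` \bigcap_l E (n0 + j)%N l by [].
rewrite -lee_fin -[in leRHS]pE FS setIC -qP //.
apply: (@le_trans _ _ (\int[P]_(w in F j) (cst ((1 - x j) ^+ N)%:E) w)%E).
  rewrite integral_cst //.
  apply: (@le_trans _ _ ((1 - x j) ^+ N * p j)%:E); last first.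
    by rewrite EFinM -pE; exact: lexx.
  rewrite lee_fin ler_pM2r //.
  exact: bernoulli_ineq.
case/andP: (x01 j) => x0 x1.
have x1' : 0 <= 1 - x j by rewrite subr_ge0.
apply: ge0_le_integral => //.
- by move=> w _; rewrite lee_fin exprn_ge0.
- by have /measurable_int := qint; apply: measurable_funS.
- move=> w Fw; rewrite lee_fin.
  rewrite -[N in leLHS]card_ord -prodr_const; apply: ler_prod => l _.
  by rewrite x1' /=; apply: q_ge => i; exact: U_F_le.
Qed.

(** Beyond some [J] the losses [N * x k] sum to at most 1/2, so [p] keeps at least half of the
    positive value [p J] forever. *)
Let p_lower : exists2 c, 0 < c & forall j, c <= p j.
Proof.
have [J HJ] : exists J, forall m, \sum_(J <= k < m) N%:R * x k <= 1 / 2.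
  (* The factor [a n0] cancels the denominator of [x]; [N.+1] replaces [N] to avoid a division by
     zero, [N] being arbitrary here. *)
  have [|J HJ] := @a_tail (a n0 / (2 * N.+1%:R)); first by rewrite divr_gt0 ?mulr_gt0.
  exists J.+1 => m; rewrite -mulr_sumr.
  have [mJ|Jm] := leqP m J.+1; first by rewrite big_geq // mulr0 divr_ge0.
  have N1 : 0 < N.+1%:R :> R by [].
  have /HJ : (J <= n0 + J)%N by exact: leq_addl.
  move=> /(_ (n0 + m.-1)%N).
  have -> : \sum_(n0 + J <= k < n0 + m.-1) a k.+1 = a n0 * \sum_(J.+1 <= k < m) x k.
    rewrite -{2}(ltn_predK Jm) big_add1 /= mulr_sumr.
    rewrite addnC [in X in \sum_(_ <= _ < X) _]addnC big_addn addnK.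
    by apply: eq_bigr => k _; rewrite /x mulrC divfK ?lt0r_neq0 // addnS addnC.
  set s := \sum_(_ <= _ < _) x _ => h.
  have : s <= (2 * N.+1%:R)^-1 by rewrite -(ler_pM2l (a_gt0 n0)).
  have s0 : 0 <= s by apply: sumr_ge0 => k _; case/andP: (x01 k).
  rewrite -[_^-1]mul1r ler_pdivlMr ?mulr_gt0 // -(natr1 N) => ?; lra.
(* Weierstrass' product inequality by induction: [(1 - y) * (1 - s) >= 1 - (s + y)], where
   [1 - y >= 0] because [s + y <= 1 / 2]. *)
have Jp i : (1 - \sum_(J <= k < J + i) N%:R * x k) * p J <= p (J + i)%N.
  elim: i => [|i IH]; first by rewrite addn0 big_geq // subr0 mul1r.
  rewrite addnS; apply: le_trans (p_step _).
  have := HJ (J + i).+1; rewrite big_nat_recr ?leq_addr //=.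
  set s := \sum_(_ <= _ < _) _ in IH *; set y := N%:R * x _ => sy.
  have y0 : 0 <= y by rewrite mulr_ge0 //; case/andP: (x01 (J + i)).
  have s0 : 0 <= s.
    by apply: sumr_ge0 => k _; rewrite mulr_ge0 //; case/andP: (x01 k).
  have h1 : (1 - y) * ((1 - s) * p J) <= (1 - y) * p (J + i)%N.
    by rewrite ler_wpM2l //; lra.
  apply: le_trans h1; rewrite mulrA ler_pM2r //.
  have : 0 <= y * s by rewrite mulr_ge0.
  lra.
exists (p J / 2) => [|j]; first by rewrite divr_gt0.
apply: (@le_trans _ _ (p (J + j)%N)).
  apply: le_trans (Jp j); rewrite mulrC ler_pM2r //; have := HJ (J + j)%N; lra.
rewrite -lee_fin -!pE; apply: le_measure; rewrite ?inE //.
by apply/subsetPset/F_anti; exact: leq_addl.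
Qed.

(** The witness is the intersection of the decreasing events [F j]: continuity from above passes the
    uniform bound [p_lower] to it, and on it [U n] is at most [a n / a n0], which tends to 0. *)
Lemma fixation_from : exists F', [/\ F' `<=` B, measurable F', (0 < P F')%E,
  (forall n l, (n0 <= n)%N -> F' `<=` E n l) &
  forall l w, F' w -> U n l w @[n --> \oo] --> 0].
Proof.
exists (\bigcap_j F j); split.
- by move=> w /(_ 0%N I).
- exact: bigcapT_measurable.
- have [c c0 cp] := p_lower.
  apply: (@lt_le_trans _ _ c%:E); first by rewrite lte_fin.
  have FP : P (F j) @[j --> \oo] --> P (\bigcap_j F j).
    apply: nonincreasing_cvg_mu => //; last exact: bigcapT_measurable.
    by have : (P (F 0%N) < +oo)%E by rewrite pE ltry.
  apply: (cvge_ge _ FP); apply: nearW => j.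
  by have : (c%:E <= P (F j))%E by rewrite pE lee_fin.
(* The draw [E n l] enters the intersection only at stage [(n - n0).+1]. *)
- move=> n l n0n w /(_ (n - n0).+1 I) /= [_ /(_ l I)].
  by rewrite subnKC.
- move=> l w Fw; apply/cvgrPdist_le => e e0.
  have [|m am] := @a_small (e * a n0); first by rewrite mulr_gt0.
  exists (n0 + m)%N => // n /= mn; rewrite sub0r normrN.
  have n0n : (n0 <= n)%N by apply: leq_trans mn; exact: leq_addr.
  have /(U_F_le l) : F (n - n0)%N w by exact: Fw.
  rewrite /x subnKC // => Ux; case/andP: (U01 n l w) => U0 _.
  rewrite ger0_norm //; apply: le_trans Ux _; rewrite ler_pdivrMr //.
  apply: le_trans am; apply: a_anti; apply: leq_trans mn; exact: leq_addl.
Qed.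

End Fixation.

Lemma absorption_gt0 n0 (S : {set 'I_N}) B : (exists i, i \in S) -> G n0 B ->
  (0 < P B)%E -> (forall l w, l \in S -> B w -> U n0 l w < 1) ->
  exists m F, [/\ F `<=` B, measurable F, (0 < P F)%E,
    (forall n l, (m <= n)%N -> F `<=` E n l) &
    forall l w, F w -> U n l w @[n --> \oo] --> 0].
Proof.
move=> S0 GB PB UB.
have [m [B' [B'B GB' PB' UB']]] := spread (leqnn _) S0 GB PB UB.
have [F [FB' mF PF EF UF]] := fixation_from GB' PB' UB'.
by exists m, F; split=> //; exact: subset_trans FB' B'B.
Qed.

End Absorption.

(** * Positive conditional probabilities and complements *)

Section Conditional.
Context d (T : measurableType d) (R : realType) (P : probability T R).

(** The set [C] takes in the null set where an almost sure property fails. If [A] met [B] in a null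
    set, [F] would be covered by two negligible sets. *)
Lemma cond_prob_event_gt0 (A B F C : set T) :
  measurable A -> measurable B -> measurable F -> P.-negligible C ->
  (0 < P F)%E -> F `<=` B -> F `<=` A `|` C -> 0 < cond_prob_event P A B.
Proof.
move=> mA mB mF C0 PF FB FA.
have mAB := measurableI _ _ mA mB.
have PAB : (0 < P (A `&` B))%E.
  rewrite lt0e measure_ge0 andbT; apply/eqP => /(negligibleP P mAB) AB0.
  have : P.-negligible F.
    apply: negligibleS (negligibleU AB0 C0) => w Fw.
    by have [Aw|Cw] := FA w Fw; [left; split => //; exact: FB|right].
  by move=> /(measure_negligible mF) F0; rewrite F0 ltxx in PF.
have PB : (0 < P B)%E.
  by apply: lt_le_trans PAB _; apply: le_measure; rewrite ?inE //; exact: subIsetr.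
by rewrite /cond_prob_event divr_gt0 //; apply: fine_gt0;
  rewrite ?PAB ?PB ltey_eq fin_num_measure.
Qed.

Lemma negligible_exists_gt0 (I : finType) (A : I -> set T) (B : set T) :
  (forall i, measurable (A i)) -> measurable B -> (0 < P B)%E ->
  (forall w, B w -> exists i, A i w) -> exists i, (0 < P (A i `&` B))%E.
Proof.
move=> mA mB PB BA; apply: contrapT => no_i.
have AB0 i : P.-negligible (A i `&` B).
  have mAB := measurableI _ _ (mA i) mB.
  apply/(negligibleP P mAB)/eqP; rewrite eq_le measure_ge0 andbT leNgt.
  by apply/negP => ?; apply: no_i; exists i.
have : P.-negligible B.
  apply: (@negligibleS _ _ _ P (\big[setU/set0]_i (A i `&` B))).
    by move=> w Bw; have [i Aiw] := BA w Bw; rewrite (bigD1 i) //; left.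
  apply: (big_ind (fun C => P.-negligible C)) => //; first exact: negligible_set0.
  by move=> *; exact: negligibleU.
by move=> /(measure_negligible mB) B0; rewrite B0 ltxx in PB.
Qed.

(** The network prescribes the conditional probability of the value 1 only; this yields that of the
    value 0. *)
Lemma is_cond_prob_setC (G : set (set T)) (A : set T) (Y : T -> R) :
  G `<=` measurable -> measurable A -> is_cond_prob P G A Y ->
  is_cond_prob P G (~` A) (fun w => 1 - Y w).
Proof.
move=> Gm mA [YG Yint YP]; split.
- move=> _ [C mC <-]; apply: YG.
  exists ((fun x : R => 1 - x) @^-1` C) => //.
  rewrite -[X in measurable X]setTI.
  have : measurable_fun setT (fun x : R => 1 - x) by apply: measurable_funB.
  by apply.
- have -> : EFin \o (fun w => 1 - Y w) = ((EFin \o cst 1%R) \- (EFin \o Y))%E by [].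
  by apply: integrableB => //; exact: finite_measure_integrable_cst.
- move=> B GB; have mB := Gm B GB.
  under eq_integral do rewrite EFinB.
  rewrite integralB //; last 2 first.
  + exact: finite_measure_integrable_cst.
  + exact: integrableS Yint.
  rewrite YP // integral_cst // mul1e [~` A `&` B]setIC -setDE.
  rewrite measureD //; first by rewrite [B `&` A]setIC.
  by rewrite ltey_eq fin_num_measure.
Qed.

End Conditional.

(** * The network as an instance of the abstract system *)

Section Network.
Context d (T : measurableType d) (R : realType) (P : probability T R).
Context (N : nat) (W : 'M[R]_N) (r : nat -> R).
Context (Z X : nat -> 'I_N -> {RV P >-> R}).

Let G n := network_filtration Z X n.

Lemma network_filtration_measurable n : G n `<=` measurable.
Proof.
apply: smallest_sub; first exact: sigma_algebra_measurable.
by move=> A [[l _]|[k _ [l _]]] [B mB <-]; exact: measurable_funP.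
Qed.

Lemma network_filtration_setI n (A B : set T) :
  G n A -> G n B -> G n (A `&` B).
Proof. exact: (@measurableI _ (g_sigma_algebraType _)). Qed.

Lemma network_filtration_incr n : G n `<=` G n.+1.
Proof.
apply: sub_sigma_algebra2 => A [?|[k /= /andP[k1 kn] Ak]]; first by left.
by right; exists k => //=; rewrite k1 leqW.
Qed.

Lemma network_filtration_bigcap n (A : 'I_N -> set T) :
  (forall l, G n (A l)) -> G n (\bigcap_l A l).
Proof.
move=> GA; apply: (@fin_bigcap_measurable _ (g_sigma_algebraType _)) => // l _.
exact: GA.
Qed.

Lemma network_filtration_X n l (C : set R) :
  measurable C -> G n.+1 (X n.+1 l @^-1` C).
Proof.
move=> mC; apply: sub_sigma_algebra; right; exists n.+1 => /=; first by rewrite leqnn.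
by exists l => //; exists C => //; rewrite setTI.
Qed.

Lemma network_filtration_Z0 l (C : set R) :
  measurable C -> G 0 (Z 0 l @^-1` C).
Proof.
move=> mC; apply: sub_sigma_algebra; left.
by exists l => //; exists C => //; rewrite setTI.
Qed.

Lemma network_filtration_trivial_startC : G 0 (~` trivial_start Z).
Proof.
have -> : trivial_start Z =
    \bigcap_l (Z 0 l @^-1` [set 0]) `|` \bigcap_l (Z 0 l @^-1` [set 1]).
  by congr (_ `|` _); apply/seteqP; split=> w /= H l => [_|]; apply: H.
apply: (@measurableC _ (g_sigma_algebraType _)).
by apply: (@measurableU _ (g_sigma_algebraType _));
  apply: network_filtration_bigcap => l; apply: network_filtration_Z0.
Qed.

Lemma fixation_measurable (z : R) : measurable (fixation X z).
Proof.
have -> : fixation X z = \bigcup_(m in [set m | (1 <= m)%N])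
    \bigcap_(n in [set n | (m <= n)%N]) \bigcap_l (X n l @^-1` [set z]).
  apply/seteqP; split=> w [m m1 H]; exists m => //.
    by move=> n /= mn l _; exact: H.
  by move=> n l mn; exact: (H n mn l I).
apply: bigcup_measurable => m _; apply: bigcap_measurable => [|n _]; first by exists m => /=.
by apply: fin_bigcap_measurable => // l _; exact: measurable_funPTI.
Qed.

Context (hnet : reinforced_network W r Z X).

Lemma network_Z01 n l w : 0 <= Z n l w <= 1.
Proof.
elim: n => [|n IH]; first exact: network_Z0 hnet l w.
rewrite (network_rec hnet); have /andP[r0 r1] := network_r hnet n.
have /andP[Z0 Z1] := IH.
have r1' : 0 <= 1 - r n by rewrite subr_ge0 ltW.
have : 0 <= (1 - r n) * Z n l w by rewrite mulr_ge0.
have : (1 - r n) * Z n l w <= (1 - r n) * 1 by rewrite ler_wpM2l.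
by case: (network_X01 hnet n l w) => -> *; apply/andP; split; lra.
Qed.

(** The distance to [z] is [Z] for [z = 0] and [1 - Z] for [z = 1]; in the second case the unit
    column sums of [W] cancel the two constants. *)
Lemma network_prob_eq (z : R) n l : z = 0 \/ z = 1 ->
  is_cond_prob P (G n) (X n.+1 l @^-1` [set z])
    (fun w => 1 - \sum_l1 W l1 l * `|Z n l1 w - z|).
Proof.
have X1 := network_prob hnet n l.
case=> ->.
- have -> : X n.+1 l @^-1` [set 0] = ~` [set w | X n.+1 l w = 1].
    apply/seteqP; split=> w /=; first by move=> ->; apply/eqP; rewrite eq_sym oner_neq0.
    by case: (network_X01 hnet n l w).
  have -> : (fun w => 1 - \sum_l1 W l1 l * `|Z n l1 w - 0|) =
      (fun w => 1 - \sum_l1 W l1 l * Z n l1 w).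
    apply/funext => w; congr (1 - _); apply: eq_bigr => i _.
    by rewrite subr0 ger0_norm //; case/andP: (network_Z01 n i w).
  apply: is_cond_prob_setC => //; first exact: network_filtration_measurable.
  exact: (measurable_funPTI (X n.+1 l) (measurable_set1 1)).
- have -> // : (fun w => 1 - \sum_l1 W l1 l * `|Z n l1 w - 1|) =
      (fun w => \sum_l1 W l1 l * Z n l1 w).
  apply/funext => w; rewrite -{1}(network_W_sum1 hnet l) -sumrB.
  apply: eq_bigr => i _; rewrite distrC ger0_norm; first by ring.
  by rewrite subr_ge0; case/andP: (network_Z01 n i w).
Qed.

(* Both values z are handled at once by running the absorption argument on
   the distances |Z - z|. *)
Lemma network_absorption (z : R) : irreducible_mx W -> summable_prod r ->
  (P (trivial_start Z) < 1)%E -> z = 0 \/ z = 1 ->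
  exists m F, [/\ F `<=` ~` trivial_start Z, measurable F, (0 < P F)%E,
    (forall n l, (m <= n)%N -> forall w, F w -> X n.+1 l w = z) &
    forall l w, F w -> Z n l w @[n --> \oo] --> z].
Proof.
move=> Wirr rsum PT0 z01.
pose U n l w := `|Z n l w - z|.
pose E n l := X n.+1 l @^-1` [set z].
have r01 := network_r hnet.
have mT0C := network_filtration_measurable network_filtration_trivial_startC.
have PT0C : (0 < P (~` trivial_start Z))%E.
  have mT0 : measurable (trivial_start Z) by rewrite -[trivial_start Z]setCK; exact: measurableC.
  by rewrite probability_setC // sube_gt0.
have U01 n l w : 0 <= U n l w <= 1.
  rewrite /U normr_ge0 /= ler_norml; case/andP: (network_Z01 n l w).
  by case: z01 => -> *; apply/andP; split; lra.
have mset z' : measurable (~` [set z'] : set R).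
  by apply: measurableC; exact: measurable_set1.
(* Off the trivial start some coordinate differs from [1 - z], hence has distance to [z] below 1;
   among finitely many, one fixed [l0] does so with positive probability. *)
have [|w nT0|l0 Pl] := @negligible_exists_gt0 _ _ _ P _
    (fun l => Z 0%N l @^-1` (~` [set 1 - z])) _ _ mT0C PT0C.
- by move=> l; exact: measurable_funPTI.
- apply: contrapT => no_l; apply: nT0.
  have Z1z l : Z 0%N l w = 1 - z by apply: contrapT => ?; apply: no_l; exists l.
  by case: z01 Z1z => ->; rewrite ?subr0 ?subrr; [right|left].
have U_in n l w : E n l w -> U n.+1 l w = (1 - r n) * U n l w.
  rewrite /E /U /= (network_rec hnet) => ->.
  have /andP[_ r1] := r01 n.
  have -> : (1 - r n) * Z n l w + r n * z - z = (1 - r n) * (Z n l w - z) by ring.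
  by rewrite normrM (ger0_norm (x := 1 - r n)) // subr_ge0 ltW.
have U_le n l w : U n.+1 l w <= (1 - r n) * U n l w + r n.
  rewrite /U (network_rec hnet); have /andP[r0 r1] := r01 n.
  have -> : (1 - r n) * Z n l w + r n * X n.+1 l w - z =
      (1 - r n) * (Z n l w - z) + r n * (X n.+1 l w - z) by ring.
  apply: le_trans (ler_normD _ _) _; rewrite !normrM.
  have r1' : 0 <= 1 - r n by rewrite subr_ge0 ltW.
  rewrite (ger0_norm r0) (ger0_norm r1') lerD2l ler_piMr //.
  rewrite ler_norml.
  by case: z01 => ->; case: (network_X01 hnet n l w) => ->; apply/andP; split; lra.
have E_prob n i := network_prob_eq n i z01.
have G_E n i : G n.+1 (E n i).
  by apply: network_filtration_X; exact: measurable_set1.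
(* Conditional independence enters here, turning the joint hitting probability into a product. *)
have bigcapE_prob n := network_indep hnet (fun _ => measurable_set1 z) (E_prob n).
have GB : G 0%N (Z 0%N l0 @^-1` (~` [set 1 - z]) `&` ~` trivial_start Z).
  by apply: network_filtration_setI; [exact: network_filtration_Z0
    |exact: network_filtration_trivial_startC].
have [|k w /set1P-> [/= Zl _]|m [F [FB mF PF EF UF]]] :=
  absorption_gt0 (network_W_ge0 hnet) (network_W_sum1 hnet) Wirr r01 rsum U01
    U_in U_le network_filtration_measurable network_filtration_setI
    network_filtration_incr G_E (fun n => network_filtration_bigcap (G_E n))
    E_prob bigcapE_prob (S := [set l0]%SET) _ GB Pl.
- by exists l0; rewrite inE.
- rewrite lt_neqAle; case/andP: (U01 0%N l0 w) => _ ->; rewrite andbT.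
  apply/eqP => U1; apply: Zl; move: U1; rewrite /U.
  have /andP[Z0 Z1] := network_Z01 0%N l0 w.
  case: z01 => ->.
    by rewrite !subr0 ger0_norm.
  by rewrite distrC ger0_norm ?subr_ge0 // => ?; lra.
exists m, F; split=> //.
  by move=> w /FB[].
move=> i w Fw; apply/cvgrPdist_le => e e0.
have /cvgrPdist_le/(_ e e0) := UF i w Fw.
apply: filterS => n; rewrite sub0r normrN /U ger0_norm // distrC.
by [].
Qed.

End Network.

Theorem theorem3p2 (R : realType) (d : measure_display) (T : measurableType d)
    (P : probability T R) (N : nat) (W : 'M[R]_N) (r : nat -> R)
    (Z X : nat -> 'I_N -> {RV P >-> R})
    (hN : (2 <= N)%N)
    (hnet : reinforced_network W r Z X)
    (hirr : irreducible_mx W)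
    (hT0 : (P (trivial_start Z) < 1)%E) :
  (sync_condition W r -> summable_prod r ->
     (forall Zinf : {RV P >-> R}, is_common_limit Z Zinf ->
        (forall z : R, z = 0 \/ z = 1 ->
           0 < cond_prob_event P [set w | Zinf w = z] (~` trivial_start Z)) /\
        0 < cond_prob_event P ([set w | Zinf w = 0] `|` [set w | Zinf w = 1])
              (~` trivial_start Z)) /\
     (forall z : R, z = 0 \/ z = 1 ->
        0 < cond_prob_event P (fixation X z) (~` trivial_start Z))) /\
  (forall gamma c : R,
     (gamma = 1 /\ 1 < c) \/ (1 / 2 < gamma < 1 /\ 0 < c) ->
     (fun n : nat => n%:R `^ gamma * r n) @ \oo --> c ->
     cvgn (fun n : nat => \sum_(1 <= k < n) (r k - c * k%:R `^ (- gamma))) ->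
     sync_condition W r /\ summable_prod r).
Proof.
split; last by move=> gamma c gc rc _; exact: step_size_conditions (network_r hnet) gc rc.
move=> _ rsum.
have mT0C := network_filtration_measurable (@network_filtration_trivial_startC _ _ _ P _ Z X).
have absorb z := network_absorption hnet (z := z) hirr rsum hT0.
split=> [Zinf Zlim|z /absorb[m [F [FT0 mF PF XF _]]]]; last first.
  apply: (cond_prob_event_gt0 _ mT0C mF (negligible_set0 P) PF FT0).
    exact: fixation_measurable.
  (* [F] controls [X n.+1] for [n >= m], so fixation starts at time [m.+1], which also excludes the
     dummy [X 0]. *)
  move=> w Fw; left; exists m.+1 => // -[|n] l // mn; exact: XF.
have mZinf z : measurable [set w | Zinf w = z].
  exact: (measurable_funPTI Zinf (measurable_set1 z)).
have l : 'I_N by exact: Ordinal hN.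
(* Stated for any [A] containing the event that the limit is [z], so as to cover both single values
   and their union. *)
have limit_gt0 A z : measurable A -> [set w | Zinf w = z] `<=` A -> z = 0 \/ z = 1 ->
    0 < cond_prob_event P A (~` trivial_start Z).
  move=> mA zA /absorb[m [F [FT0 mF PF _ ZF]]].
  apply: (cond_prob_event_gt0 mA mT0C mF (Zlim l) PF FT0) => w Fw.
  (* Where the almost sure convergence holds, uniqueness of limits identifies [Zinf w] with [z]; the
     other points form the negligible set. *)
  have [Zw|] := pselect (Z n l w @[n --> \oo] --> Zinf w); last by right.
  left; apply: zA; apply: cvg_unique Zw (ZF l w Fw).
  exact: Rhausdorff.
split; first by move=> z; exact: limit_gt0.
apply: (limit_gt0 _ 0); [exact: measurableU|exact: subsetUl|by left].
Qed.
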